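(* Let $A,B\subseteq\omega$ be oracles, and let $\gamma$ be a $(2,B)$-divisible numbering. If $\mathrm{Skolem}(A,B,\gamma)$ then $A\leq_T B$.
   Context: A numbering is a surjection $\gamma:\omega\to S$ onto a set $S$; write $n\sim_\gamma m$ iff $\gamma(n)=\gamma(m)$, and let $[x]_{\sim_\gamma}$ be the equivalence class of $x$. $W^B_e$ is the $e$-th $B$-c.e. set in the standard numbering. $\gamma$ is $(2,B)$-divisible if there are $B$-computable sequences $(x_i)_{i<2}$ and $(e_i)_{i<2}$ of natural numbers such that (i) $[x_i]_{\sim_\gamma}\subseteq W^B_{e_i}$ for all $i<2$, and (ii) $[x_i]_{\sim_\gamma}\cap W^B_{e_j}=\emptyset$ for all distinct $i,j<2$. $\mathrm{Skolem}(A,B,\gamma)$ means: for every (total) $A$-computable binary function $h:\omega^2\to\omega$ there is a (total) $B$-computable function $f:\omega\to\omega$ such that $h(n,f(n))\sim_\gamma f(n)$ for all $n\in\omega$. *)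

(* Defs.v *)
From HB Require Import structures.
From Stdlib Require List.
From mathcomp Require Import all_boot.
From mathcomp Require Import boolp classical_sets.

Set Implicit Arguments.
Unset Strict Implicit.
Unset Printing Implicit Defensive.

Local Open Scope classical_set_scope.

(** Partial functions on tuples of naturals, given by their graphs. *)
Definition pfun := seq nat -> nat -> Prop.

(** [F (G_1 xs, ..., G_k xs)]; strict, i.e. every [G_i xs] must be defined. *)
Definition pcomp (F : pfun) (Gs : seq pfun) : pfun := fun xs y =>
  exists2 ys, List.Forall2 (fun (G : pfun) z => G xs z) Gs ys & F ys y.

(** [h (0, xs) = F xs] and [h (m + 1, xs) = G (m, h (m, xs), xs)]. *)
Definition pprec (F G : pfun) : pfun := fun nxs =>
  let xs := behead nxs in
  (fix h n y := if n is m.+1 then exists2 z, h m z & G [:: m, z & xs] y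
                else F xs y) (head 0 nxs).

(** The least [y] with [F (y, xs) = 0], all earlier values being defined. *)
Definition pmin (F : pfun) : pfun := fun xs y =>
  F (y :: xs) 0 /\ forall z, z < y -> exists v, F (z :: xs) v.+1.

(** Partial recursive functions with an oracle. Codes carry no arity: each one
    denotes a function of every arity, absent arguments being read as 0. *)
Inductive code :=
| Zero
| Succ
| Oracle
| Proj of nat
| Comp of code & seq code
| Prec of code & code
| Min of code.

Fixpoint eval (B : set nat) (c : code) : pfun :=
  match c with
  | Zero => fun _ y => y = 0
  | Succ => fun xs y => y = (head 0 xs).+1
  | Oracle => fun xs y => y = nat_of_bool (head 0 xs \in B)
  | Proj i => fun xs y => y = nth 0 xs i
  | Comp f gs => pcomp (eval B f) [seq eval B g | g <- gs]
  | Prec f g => pprec (eval B f) (eval B g)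
  | Min f => pmin (eval B f)
  end.

(** The Goedel numbering of codes is [pickle], through finite labelled trees;
    both [pickle] and [unpickle] are effective on these. *)
Fixpoint tree_of_code (c : code) : GenTree.tree nat :=
  match c with
  | Zero => GenTree.Node 0 [::]
  | Succ => GenTree.Node 1 [::]
  | Oracle => GenTree.Node 2 [::]
  | Proj i => GenTree.Leaf i
  | Comp f gs => GenTree.Node 3 (tree_of_code f :: map tree_of_code gs)
  | Prec f g => GenTree.Node 4 [:: tree_of_code f; tree_of_code g]
  | Min f => GenTree.Node 5 [:: tree_of_code f]
  end.

Fixpoint code_of_tree (t : GenTree.tree nat) : code :=
  match t with
  | GenTree.Node 1 _ => Succ
  | GenTree.Node 2 _ => Oracle
  | GenTree.Leaf i => Proj i
  | GenTree.Node 3 (f :: gs) => Comp (code_of_tree f) (map code_of_tree gs)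
  | GenTree.Node 4 [:: f; g] => Prec (code_of_tree f) (code_of_tree g)
  | GenTree.Node 5 [:: f] => Min (code_of_tree f)
  | _ => Zero
  end.

Lemma tree_of_codeK : cancel tree_of_code code_of_tree.
Proof.
rewrite /cancel; fix IH 1 => -[ | | | i | f gs | f g | f] /=.
- by [].
- by [].
- by [].
- by [].
- by rewrite IH; congr Comp; elim: gs => [//|g gs /= ->]; rewrite IH.
- by rewrite !IH.
- by rewrite IH.
Qed.

HB.instance Definition _ := Countable.copy code (can_type tree_of_codeK).

Definition computable1 (B : set nat) (f : nat -> nat) : Prop :=
  exists c, forall n, eval B c [:: n] (f n).

Definition computable2 (B : set nat) (h : nat -> nat -> nat) : Prop :=
  exists c, forall m n, eval B c [:: m; n] (h m n).

Definition turing_le (A B : set nat) : Prop :=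
  computable1 B (fun n => nat_of_bool (n \in A)).

(** The [e]-th [B]-c.e. set, the domain of the [e]-th unary partial
    [B]-computable function. Numbers that code nothing index the empty set. *)
Definition W (B : set nat) (e : nat) : set nat :=
  if unpickle e is Some c then [set n | exists y, eval B c [:: n] y] else set0.

Definition numbering (S : Type) (gamma : nat -> S) : Prop :=
  forall s, exists n, gamma n = s.

Definition num_eq (S : Type) (gamma : nat -> S) (n m : nat) : Prop :=
  gamma n = gamma m.

Definition num_class (S : Type) (gamma : nat -> S) (x : nat) : set nat :=
  [set n | num_eq gamma n x].

(** A [B]-computable sequence of length [k] is given by the first [k] values of
    a total [B]-computable function. *)
Definition divisible (k : nat) (B : set nat) (S : Type) (gamma : nat -> S) :
    Prop :=
  exists x e : nat -> nat,
    [/\ computable1 B x, computable1 B e,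
        forall i, i < k -> num_class gamma (x i) `<=` W B (e i)
      & forall i j, i < k -> j < k -> i <> j ->
          num_class gamma (x i) `&` W B (e j) = set0].

Definition Skolem (A B : set nat) (S : Type) (gamma : nat -> S) : Prop :=
  forall h : nat -> nat -> nat, computable2 A h ->
    exists2 f : nat -> nat, computable1 B f
      & forall n, num_eq gamma (h n (f n)) (f n).

(* Main.v *)
Require Import Defs.
From Stdlib Require List.
From mathcomp Require Import all_boot.
From mathcomp Require Import boolp classical_sets.

Set Implicit Arguments.
Unset Strict Implicit.
Unset Printing Implicit Defensive.

(** Let [a] and [b] be the two numbers given by divisibility, and [U], [V] the
    [B]-c.e. sets with [[a] `<=` U], [[b] `<=` V], [U] disjoint from [[b]] and
    [V] disjoint from [[a]]. The function [h n x] which is [a] for [n] in [A]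
    and [b] otherwise is [A]-computable and ignores [x], so its Skolemized fixed
    points [f n] are forced to be equivalent to [a] or to [b] according to
    whether [n] is in [A]. Hence [f n] lies in exactly one of [U] and [V], and
    it lies in [U] if and only if [n] is in [A]. Since [f] is [B]-computable,
    enumerating [U] and [V] in parallel until [f n] shows up decides [A] from
    [B] ([separation_decides]).

    The parallel enumeration is where work is needed: running a code for [U] to
    its end may diverge before the code for [V] is given a chance. Every code
    [c] is therefore approximated by a total function [step c s xs], in which
    the fuel [s] bounds every unbounded search. These approximations increase
    with [s] ([step_mono]), they converge exactly to the partial function of [c]
    ([step_sound], [step_complete]), and, for each fixed number of arguments,
    they are themselves computable from the same oracle ([total_step]). Thus a
    [B]-c.e. set is a projection of a [B]-decidable relation, and one unbounded
    search on the fuel runs both enumerations at once. *)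

(** * Total computable functions of a fixed number of arguments *)

Section Total.
Variable B : set nat.

Definition total (k : nat) (F : seq nat -> nat) : Prop :=
  exists c, forall xs, size xs = k -> eval B c xs (F xs).

(** Argument lists are built as one function into sequences, because the list of
    arguments of a composition has a length that depends on the code. *)
Definition totals (k m : nat) (L : seq nat -> seq nat) : Prop :=
  exists cs, forall xs, size xs = k -> size (L xs) = m /\
    List.Forall2 (fun (G : pfun) y => G xs y) [seq eval B c | c <- cs] (L xs).

Lemma eq_total k F G :
  (forall xs, size xs = k -> F xs = G xs) -> total k F -> total k G.
Proof. by move=> eFG [c Pc]; exists c => xs Hxs; rewrite -eFG //; apply: Pc. Qed.

Lemma eq_totals k m L M :
  (forall xs, size xs = k -> L xs = M xs) -> totals k m L -> totals k m M.
Proof. by move=> eLM [c Pc]; exists c => xs Hxs; rewrite -eLM //; apply: Pc. Qed.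

Lemma total_nth k i : total k (fun xs => nth 0 xs i).
Proof. by exists (Proj i). Qed.

Lemma totals_nil k : totals k 0 (fun=> [::]).
Proof. by exists [::] => xs _; split=> //; constructor. Qed.

Lemma totals_cons k m F L :
  total k F -> totals k m L -> totals k m.+1 (fun xs => F xs :: L xs).
Proof.
move=> [c Pc] [cs Pcs]; exists (c :: cs) => xs Hxs.
have [sL eL] := Pcs xs Hxs; split; first by rewrite /= sL.
by constructor=> //; apply: Pc.
Qed.

Lemma totals_drop k j : totals k (k - j) (drop j).
Proof.
move Em: (k - j) => m; elim: m j Em => [|m IHm] j Hm.
  apply: eq_totals (totals_nil k) => xs Hxs.
  by rewrite drop_oversize // Hxs -subn_eq0 Hm.
have ltjk : j < k by rewrite -subn_gt0 Hm.
apply: eq_totals (totals_cons (total_nth k j) (IHm j.+1 _)).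
  by move=> xs Hxs; rewrite -drop_nth ?Hxs.
by rewrite subnS Hm.
Qed.

Lemma total_comp k m F L : total m F -> totals k m L -> total k (F \o L).
Proof.
move=> [c Pc] [cs Pcs]; exists (Comp c cs) => xs Hxs.
have [sL eL] := Pcs xs Hxs.
by exists (L xs) => //; apply: Pc.
Qed.

Lemma total_iter k F G : total k F -> total k.+2 G ->
  total k.+1 (fun xs => iteri (head 0 xs)
    (fun m z => G [:: m, z & behead xs]) (F (behead xs))).
Proof.
move=> [c Pc] [d Pd]; exists (Prec c d) => -[|n xs] //= [Hxs].
rewrite /pprec /=; elim: n => [|n IHn] /=; first exact: Pc.
by eexists; [exact: IHn | apply: Pd; rewrite /= Hxs].
Qed.

Lemma total_min k F (G : seq nat -> nat) : total k.+1 F ->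
  (forall xs, size xs = k -> F (G xs :: xs) = 0) ->
  (forall xs z, size xs = k -> z < G xs -> F (z :: xs) != 0) ->
  total k G.
Proof.
move=> [c Pc] F0 Fn0; exists (Min c) => xs Hxs; split.
  by rewrite -(F0 xs Hxs); apply: Pc; rewrite /= Hxs.
move=> z ltz; exists (F (z :: xs)).-1.
by rewrite prednK ?lt0n ?Fn0 //; apply: Pc; rewrite /= Hxs.
Qed.

Lemma total_const k a : total k (fun=> a).
Proof.
elim: a => [|a IHa]; first by exists Zero.
have tS : total 1 (fun xs => (head 0 xs).+1) by exists Succ.
exact: (total_comp tS (totals_cons IHa (totals_nil k))).
Qed.

Lemma total_app1 k F g :
  total 1 (fun xs => g (head 0 xs)) -> total k F -> total k (fun xs => g (F xs)).
Proof. by move=> tg tF; apply: (total_comp tg (totals_cons tF (totals_nil k))). Qed.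

Lemma total_succ k F : total k F -> total k (fun xs => (F xs).+1).
Proof. by apply: total_app1; exists Succ. Qed.

Lemma total_pred k F : total k F -> total k (fun xs => (F xs).-1).
Proof.
apply: total_app1.
have := total_iter (total_const 0 0) (total_nth 2 0).
by apply: eq_total => -[|[|n] [|? ?]].
Qed.

Lemma total_if k F G H : total k F -> total k G -> total k H ->
  total k (fun xs => if F xs == 0 then G xs else H xs).
Proof.
move=> tF tG tH.
have tI := total_iter (total_nth 2 0) (total_nth 4 3).
have tL := totals_cons tF (totals_cons tG (totals_cons tH (totals_nil k))).
apply: eq_total (total_comp tI tL) => xs Hxs /=.
by case: (F xs).
Qed.

Lemma total_sub k F G :
  total k F -> total k G -> total k (fun xs => F xs - G xs).
Proof.
move=> tF tG.
have tI := total_iter (total_nth 1 0) (total_pred (total_nth 3 1)).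
apply: eq_total (total_comp tI (totals_cons tG (totals_cons tF (totals_nil k)))).
move=> xs Hxs /=; elim: (G xs) => [|m IHm] /=; first by rewrite subn0.
by rewrite IHm subnS.
Qed.

Lemma total_oracle k F : total k F -> total k (fun xs => nat_of_bool (F xs \in B)).
Proof.
by apply: (@total_app1 _ _ (fun n => nat_of_bool (n \in B))); exists Oracle.
Qed.

(** The divergence test on the arguments of a composition: one conditional for
    each of them. *)
Lemma total_if_mem0 k (T : eqType) (gs : seq T) (F : T -> seq nat -> nat) H :
  {in gs, forall g, total k (F g)} -> total k H ->
  total k (fun xs => if 0 \in [seq F g xs | g <- gs] then 0 else H xs).
Proof.
elim: gs => [//|g gs IHgs] tF tH.
have tgs : {in gs, forall g, total k (F g)}.
  by move=> x xgs; apply: tF; rewrite inE xgs orbT.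
have tI := total_if (tF g (mem_head _ _)) (total_const k 0) (IHgs tgs tH).
by apply: eq_total tI => xs _ /=; rewrite inE eq_sym; case: eqP.
Qed.

End Total.

(** * Approximating partial computations by total ones *)

(** The recursor that the nested occurrence of [seq code] calls for. *)
Lemma code_nested_ind (P : code -> Prop) :
  P Zero -> P Succ -> P Oracle -> (forall i, P (Proj i)) ->
  (forall f gs, P f -> {in gs, forall g, P g} -> P (Comp f gs)) ->
  (forall f g, P f -> P g -> P (Prec f g)) ->
  (forall f, P f -> P (Min f)) -> forall c, P c.
Proof.
move=> P0 PS PO PP PC PR PM; fix IH 1 => -[||| i | f gs | f g | f]; [by []|by []|by []|by []|..].
- apply: PC; first exact: IH.
  suff: List.Forall P gs.
    elim: gs => [//|g gs IHgs] Pgs x.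
    rewrite inE => /orP[/eqP->|]; first by inversion Pgs.
    by apply: IHgs; inversion Pgs.
  by elim: gs => [|g gs IHgs]; constructor; [apply: IH | apply: IHgs].
- by apply: PR; apply: IH.
- by apply: PM; apply: IH.
Qed.

Section Step.
Variable B : set nat.

(** The value is [y.+1] when the computation with fuel [s] returns [y], and [0]
    when the fuel does not suffice. *)
Fixpoint step (c : code) (s : nat) (xs : seq nat) : nat :=
  match c with
  | Zero => 1
  | Succ => (head 0 xs).+2
  | Oracle => (nat_of_bool (head 0 xs \in B)).+1
  | Proj i => (nth 0 xs i).+1
  | Comp f gs =>
      let vs := [seq step g s xs | g <- gs] in
      if 0 \in vs then 0 else step f s [seq v.-1 | v <- vs]
  | Prec f g =>
      iteri (head 0 xs)
        (fun m v => if v == 0 then 0 else step g s [:: m, v.-1 & behead xs])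
        (step f s (behead xs))
  | Min f =>
      let y := find (fun z => step f s (z :: xs) <= 1) (iota 0 s) in
      if step f s (y :: xs) == 1 then y.+1 else 0
  end.

Lemma mem0_map_succ ys : (0 \in [seq y.+1 | y <- ys]) = false.
Proof. by apply/mapP => -[]. Qed.

Lemma map_succK ys : [seq v.-1 | v <- [seq y.+1 | y <- ys]] = ys.
Proof. by rewrite -map_comp map_id. Qed.

Lemma step_comp f gs s xs ys :
    [seq step g s xs | g <- gs] = [seq y.+1 | y <- ys] ->
  step (Comp f gs) s xs = step f s ys.
Proof. by move=> /= ->; rewrite mem0_map_succ map_succK. Qed.

Lemma step_compP f gs s xs y : step (Comp f gs) s xs = y.+1 ->
  exists2 ys, [seq step g s xs | g <- gs] = [seq y.+1 | y <- ys]
            & step f s ys = y.+1.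
Proof.
move=> /=; case: ifPn => // vs0; eexists; last by eassumption.
rewrite -map_comp -[LHS]map_id; apply/eq_in_map => -[|v] // v0.
by rewrite v0 in vs0.
Qed.

(** The search of [step (Min f)] stops at [y <= s], where running out of
    candidates at [y = s] is harmless: the value at [y] is tested anyway. *)
Lemma step_minP f s xs y : step (Min f) s xs = y.+1 ->
  [/\ y <= s, step f s (y :: xs) = 1 & forall z, z < y -> 1 < step f s (z :: xs)].
Proof.
rewrite /=; set p := fun z => _ <= 1; case: eqP => // Hy [Ey]; rewrite -{}Ey.
have les := find_size p (iota 0 s); rewrite size_iota in les.
split=> // z ltz; have := before_find 0 ltz.
by rewrite nth_iota ?(leq_trans ltz) // add0n ltnNge /p => ->.
Qed.

Lemma step_min f s xs y : y <= s -> step f s (y :: xs) = 1 ->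
    (forall z, z < y -> 1 < step f s (z :: xs)) ->
  step (Min f) s xs = y.+1.
Proof.
move=> leys Hy Hz /=; set p := fun z => _ <= 1.
suff -> : find p (iota 0 s) = y by rewrite Hy.
have les := find_size p (iota 0 s); rewrite size_iota in les.
apply/eqP; rewrite eqn_leq; apply/andP; split; rewrite leqNgt; apply/negP => lt.
  have := before_find 0 lt; rewrite nth_iota ?(leq_trans lt) // add0n.
  by rewrite /p Hy.
have ltfs := leq_trans lt leys.
have: has p (iota 0 s) by rewrite has_find size_iota.
move=> /(nth_find 0); rewrite nth_iota // add0n /p leqNgt.
by move=> /negP; apply; apply: Hz.
Qed.

Lemma step_mono c s s' xs y :
  s <= s' -> step c s xs = y.+1 -> step c s' xs = y.+1.
Proof.
move=> les; elim/code_nested_ind: c xs y => //.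
- move=> f gs IHf IHgs xs y /step_compP[ys Eys Ey].
  rewrite (@step_comp _ _ _ _ ys); first exact: IHf.
  elim: gs ys IHgs Eys {Ey} => [|g gs IH] [|z zs] //= IHgs [Ez Ezs].
  rewrite (IHgs g _ _ z) ?mem_head // (IH zs) // => x xgs.
  by apply: IHgs; rewrite inE xgs orbT.
- move=> f g IHf IHg xs y /=.
  elim: (head 0 xs) y => [|n IHn] y /=; first exact: IHf.
  case E: (iteri n _ _) => [//|v] /= H; rewrite (IHn v E) /=.
  exact: IHg.
- move=> f IHf xs y /step_minP[leys Hy Hz].
  apply: step_min; [exact: leq_trans leys les | exact: IHf |].
  move=> z /Hz; case E: step => [|[|v]] // _.
  by rewrite (IHf _ _ E).
Qed.

Lemma step_sound c s xs y : step c s xs = y.+1 -> eval B c xs y.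
Proof.
elim/code_nested_ind: c xs y => [xs y [<-]|xs y [<-]|xs y [<-]|i xs y [<-]|||] //.
- move=> f gs IHf IHgs xs y /step_compP[ys Eys Ey].
  exists ys; last exact: IHf.
  elim: gs ys IHgs Eys {Ey} => [|g gs IH] [|z zs] //= IHgs.
  move=> [Ez Ezs]; constructor; first by apply: IHgs Ez; rewrite mem_head.
  by apply: IH => // x xgs; apply: IHgs; rewrite inE xgs orbT.
- move=> f g IHf IHg xs y /=; rewrite /pprec.
  elim: (head 0 xs) y => [|n IHn] y /=; first exact: IHf.
  case E: (iteri n _ _) => [//|v] /= H.
  by exists v; [exact: IHn | exact: IHg].
- move=> f IHf xs y /step_minP[_ Hy Hz]; split; first exact: IHf.
  move=> z /Hz; case E: step => [|[|v]] // _.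
  by exists v; apply: IHf.
Qed.

(** A converging computation consists of finitely many subcomputations, and by
    monotonicity the largest of their fuels suffices for all of them. *)
Lemma step_complete c xs y : eval B c xs y -> exists s, step c s xs = y.+1.
Proof.
elim/code_nested_ind: c xs y =>
  [xs y ->|xs y ->|xs y ->|i xs y ->|||]; try by exists 0.
- move=> f gs IHf IHgs xs y [ys Hgs /IHf[s Hs]].
  have [t Ht] : exists t, [seq step g t xs | g <- gs] = [seq y.+1 | y <- ys].
    elim: gs ys IHgs Hgs {Hs} => [|g gs IH] [|z zs] IHgs Hgs; try by inversion Hgs.
      by exists 0.
    have /List.Forall2_cons_iff[Hg /IH[|t Ht]] := Hgs.
      by move=> x xgs; apply: IHgs; rewrite inE xgs orbT.
    have [u Hu] := IHgs g (mem_head _ _) _ _ Hg.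
    exists (maxn u t) => /=; rewrite (step_mono (leq_maxl u t) Hu); congr (_ :: _).
    elim: gs zs Ht {IH IHgs Hgs} => [|k gs IH] [|w ws] //= [Hw Hws].
    by rewrite (step_mono (leq_maxr u t) Hw) (IH ws).
  exists (maxn s t); rewrite (@step_comp _ _ _ _ ys).
    exact: step_mono (leq_maxl s t) Hs.
  elim: gs ys Ht {IHgs Hgs Hs} => [|k gs IH] [|w ws] //= [Hw Hws].
  by rewrite (step_mono (leq_maxr s t) Hw) (IH ws).
- move=> f g IHf IHg xs y /=; rewrite /pprec.
  elim: (head 0 xs) y => [|n IHn] y /=; first exact: IHf.
  move=> [z /IHn[s Hs] /IHg[t Ht]]; exists (maxn s t).
  (* the inner iteration is [step (Prec f g)] on a shorter recursion *)
  have := @step_mono (Prec f g) _ _ (n :: behead xs) _ (leq_maxl s t) Hs.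
  by move=> /= -> /=; apply: step_mono Ht; apply: leq_maxr.
- move=> f IHf xs y [/IHf[s Hs] Hz].
  have [t Ht] : exists t, forall z, z < y -> 1 < step f t (z :: xs).
    elim: y Hz {Hs} => [|y IHy] Hz; first by exists 0.
    have [|t Ht] := IHy; first by move=> z ltzy; apply: Hz; apply: ltnW.
    have [v /IHf[u Hu]] := Hz y (ltnSn y).
    exists (maxn u t) => z; rewrite ltnS leq_eqVlt => /orP[/eqP->|/Ht].
      by rewrite (step_mono (leq_maxl u t) Hu).
    by case E: step => [|[|w]] // _; rewrite (step_mono (leq_maxr u t) E).
  (* the search range must itself reach [y] *)
  pose m := maxn y (maxn s t).
  have lesm : s <= m by rewrite !leq_max leqnn orbT.
  have letm : t <= m by rewrite !leq_max leqnn !orbT.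
  exists m; apply: step_min; first exact: leq_maxl.
    exact: step_mono Hs.
  by move=> z /Ht; case E: step => [|[|w]] // _; rewrite (step_mono letm E).
Qed.

(** The code obtained for [step c] depends on the number [k] of arguments: the
    fuel is an extra argument that must be carried past the others. *)
Lemma total_step c k : total B k.+1 (fun a => step c (head 0 a) (behead a)).
Proof.
elim/code_nested_ind: c k => [k|k|k|i k|f gs IHf IHgs k|f g IHf IHg k|f IHf k] /=.
- exact: total_const.
- apply: eq_total (total_succ (total_succ (total_nth B k.+1 1))).
  by case=> //= s xs _; rewrite nth0.
- apply: eq_total (total_succ (total_oracle (total_nth B k.+1 1))).
  by case=> //= s xs _; rewrite nth0.
- apply: eq_total (total_succ (total_nth B k.+1 i.+1)).
  by case.
- pose vs a := [seq step g (head 0 a) (behead a) | g <- gs].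
  have tL : totals B k.+1 (size gs).+1
      (fun a => nth 0 a 0 :: [seq v.-1 | v <- vs a]).
    apply: totals_cons; first exact: total_nth.
    rewrite /vs; elim: {f IHf vs} gs IHgs => [|g gs IH] IHgs /=.
      exact: totals_nil.
    apply: totals_cons; first by apply/total_pred/IHgs/mem_head.
    by apply: IH => x xgs; apply: IHgs; rewrite inE xgs orbT.
  have tF := total_comp (IHf (size gs)) tL.
  have := total_if_mem0 (fun g gs_g => IHgs g gs_g k) tF.
  by apply: eq_total => a _; rewrite /= /vs nth0.
- have tG : total B (k.-1).+3 (fun a => if nth 0 a 1 == 0 then 0 else
      step g (nth 0 a 2) [:: nth 0 a 0, (nth 0 a 1).-1 & drop 3 a]).
    apply: total_if; [exact: total_nth | exact: total_const |].
    have tL := totals_cons (total_nth B k.-1.+3 2)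
      (totals_cons (total_nth B k.-1.+3 0)
      (totals_cons (total_pred (total_nth B k.-1.+3 1)) (totals_drop B k.-1.+3 3))).
    by rewrite !subSS subn0 in tL; exact: (total_comp (IHg k.-1.+2) tL).
  have tI := total_iter (IHf k.-1) tG.
  have := totals_cons (total_nth B k.+1 1)
    (totals_cons (total_nth B k.+1 0) (totals_drop B k.+1 2)).
  rewrite subSS subn1 => /(total_comp tI); apply: eq_total.
  by case=> [//|s xs] _ /=; rewrite drop1 nth0 drop0.
- pose p s xs z := step f s (z :: xs) <= 1.
  have tf : total B k.+2 (fun a => step f (nth 0 a 1) (nth 0 a 0 :: drop 2 a)).
    have tL := totals_cons (total_nth B k.+2 1)
      (totals_cons (total_nth B k.+2 0) (totals_drop B k.+2 2)).
    by rewrite !subSS subn0 in tL; exact: (total_comp (IHf k.+1) tL).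
  have ty : total B k.+1 (fun a => find (p (head 0 a) (behead a)) (iota 0 (head 0 a))).
    (* an unbounded search, stopped at the latest when it reaches the fuel *)
    apply: (total_min (F := fun a => if nth 0 a 1 - nth 0 a 0 == 0 then 0
      else (step f (nth 0 a 1) (nth 0 a 0 :: drop 2 a)).-1)).
    + apply: total_if; last exact: total_pred.
        by apply: total_sub; apply: total_nth.
      exact: total_const.
    + case=> [//|s xs] _ /=; rewrite drop0 subn_eq0; case: leqP => // lts.
      have: has (p s xs) (iota 0 s) by rewrite has_find size_iota.
      move=> /(nth_find 0); rewrite nth_iota // add0n /p.
      by case: step => [|[]].
    + case=> [//|s xs] z _ /= ltz; rewrite drop0 subn_eq0.
      have les := find_size (p s xs) (iota 0 s); rewrite size_iota in les.
      have ltzs := leq_trans ltz les.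
      have := before_find 0 ltz; rewrite nth_iota // add0n /p (leqNgt s) ltzs /=.
      by case: step => [|[]].
  have tL := totals_cons ty (totals_drop B k.+1 0); rewrite subn0 in tL.
  have tv := total_comp tf tL.
  (* [v == 1] is the conjunction of [v.-1 == 0] and [v != 0] *)
  have := total_if (total_pred tv)
    (total_if tv (total_const B k.+1 0) (total_succ ty)) (total_const B k.+1 0).
  apply: eq_total; case=> [//|s xs] _ /=; rewrite drop0.
  by rewrite -/(p s xs); case: step => [|[]].
Qed.

End Step.

(** * Deciding by parallel enumeration *)

Lemma W_code B e n : W B e n ->
  exists c, W B e = [set n | exists y, eval B c [:: n] y]%classic.
Proof. by rewrite /W; case: unpickle => [c|] // _; exists c. Qed.

(** Of the two enumerations only the correct one ever produces [f n], so the
    first stage at which either does tells whether [P n] holds; since [P n] or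
    its negation holds, such a stage exists and the search for it is total. *)
Lemma separation_decides B (P : pred nat) f c d :
    computable1 B f ->
    (forall n, P n -> exists y, eval B c [:: f n] y) ->
    (forall n, ~~ P n -> exists y, eval B d [:: f n] y) ->
    (forall n y, P n -> ~ eval B d [:: f n] y) ->
    (forall n y, ~~ P n -> ~ eval B c [:: f n] y) ->
  computable1 B (fun n => nat_of_bool (P n)).
Proof.
move=> [cf Pf] HU HV nV nU.
have tf k F : total B k F -> total B k (fun a => f (F a)).
  by apply: total_app1; exists cf => -[|n [|? ?]] // _; exact: Pf.
pose u b n s := step B b s [:: f n].
have tu b : total B 2 (fun a => u b (nth 0 a 1) (nth 0 a 0)).
  have tn := tf _ _ (total_nth B 2 1).
  exact: (total_comp (total_step B b 1) (totals_cons (total_nth B 2 0)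
    (totals_cons tn (totals_nil B 2)))).
have uP b n y : eval B b [:: f n] y -> exists s, u b n s != 0.
  by move=> /step_complete[s Hs]; exists s; rewrite /u Hs.
have found n : exists s, (u c n s != 0) || (u d n s != 0).
  case: (boolP (P n)) => [/HU|/HV] [y /uP[s Hs]]; exists s; rewrite Hs //.
  by rewrite orbT.
pose stage n := ex_minn (found n).
have tstage : total B 1 (fun a => stage (nth 0 a 0)).
  apply: (total_min (F := fun a => if u c (nth 0 a 1) (nth 0 a 0) == 0 then
    if u d (nth 0 a 1) (nth 0 a 0) == 0 then 1 else 0 else 0)).
  - apply: total_if (tu c) (total_if (tu d) _ _) _; exact: total_const.
  - move=> a _ /=; rewrite /stage; case: ex_minnP => s.
    by do 2!case: eqP.
  - move=> a z _ /=; rewrite /stage; case: ex_minnP => s _ min_s ltz.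
    by move: (min_s z); rewrite leqNgt ltz; do 2!case: eqP => // _; move=> /(_ isT).
have [cd Pcd] : total B 1 (fun a => if u c (nth 0 a 0) (stage (nth 0 a 0)) == 0
                                    then 0 else 1).
  apply: total_if; [|exact: total_const|exact: total_const].
  exact: (total_comp (tu c) (totals_cons tstage (totals_cons (total_nth B 1 0)
    (totals_nil B 1)))).
exists cd => n; have := Pcd [:: n] erefl => /=; congr (eval B cd _ _).
have sound b s : u b n s != 0 -> eval B b [:: f n] (u b n s).-1.
  by rewrite -lt0n => u0; apply: (@step_sound B b s); rewrite -[LHS]/(u b n s) prednK.
rewrite /stage; case: ex_minnP => s Hs _.
case: (boolP (P n)) Hs => [Pn|nPn].
  by case: eqP => //= _ /sound /(nV _ _ Pn).
by case: eqP => [//|/eqP/sound /(nU _ _ nPn)].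
Qed.

Theorem corollary4p4 (A B : set nat) (S : Type) (gamma : nat -> S)
    (gamma_num : numbering gamma) (gamma_div : divisible 2 B gamma) :
  Skolem A B gamma -> turing_le A B.
Proof.
move=> sk; have [x [e [_ _ in_W notin_W]]] := gamma_div.
have [cU EU] := W_code (in_W 0 isT (x 0) erefl).
have [cV EV] := W_code (in_W 1 isT (x 1) erefl).
pose h (n _ : nat) := if nat_of_bool (n \in A) == 0 then x 1 else x 0.
have ch : computable2 A h.
  have [c Pc] := total_if (total_oracle (total_nth A 2 0))
    (total_const A 2 (x 1)) (total_const A 2 (x 0)).
  by exists c => m n; apply: (Pc [:: m; n]).
have [f cf fixf] := sk h ch.
have fA n : n \in A -> num_class gamma (x 0) (f n).
  by move=> nA; have := fixf n; rewrite /h nA.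
have fnA n : n \notin A -> num_class gamma (x 1) (f n).
  by move=> nA; have := fixf n; rewrite /h (negbTE nA).
apply: (separation_decides (f := f) (c := cU) (d := cV)) => // n.
- by move=> /fA /(in_W 0 isT); rewrite EU.
- by move=> /fnA /(in_W 1 isT); rewrite EV.
- move=> y /fA fn Hy; have /seteqP[sub _] := notin_W 0 1 isT isT (@O_S 0).
  by apply: (sub (f n)); split=> //; rewrite EV; exists y.
- move=> y /fnA fn Hy; have /seteqP[sub _] := notin_W 1 0 isT isT (nesym (@O_S 0)).
  by apply: (sub (f n)); split=> //; rewrite EU; exists y.
Qed.
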